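(* For all integers $n,m\ge0$, in the group $\tilde{\mathfrak S}_{n+m}$ one has $$\tilde\tau_{n,m}\,\tilde\tau_{m,n}=c^N,\qquad N=\binom n2\binom m2.$$
   Context: $\tilde{\mathfrak S}_n$ (the spin-symmetric group) is the group generated by $\tilde s_1,\dots,\tilde s_{n-1},c$ subject to: $c$ is central and $c^2=1$; $\tilde s_i^2=1$; $\tilde s_i\tilde s_{i+1}\tilde s_i=\tilde s_{i+1}\tilde s_i\tilde s_{i+1}$ for $1\le i\le n-2$; $\tilde s_i\tilde s_j=c\,\tilde s_j\tilde s_i$ for $|i-j|\ge2$. In $\tilde{\mathfrak S}_{n+m}$ put $\tilde\sigma_{n,i}=\tilde s_i\tilde s_{i+1}\cdots\tilde s_{i+n-1}$ for $1\le i\le m$, and $\tilde\tau_{n,m}=\tilde\sigma_{n,m}\tilde\sigma_{n,m-1}\cdots\tilde\sigma_{n,1}$ (empty products are $1$). *)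

(* Defs.v *)
From HB Require Import structures.
From mathcomp Require Import all_boot.
From mathcomp Require Import boolp.

Set Implicit Arguments.
Unset Strict Implicit.
Unset Printing Implicit Defensive.

Local Open Scope quotient_scope.
Local Open Scope group_scope.

Section Presentation.
Variable X : choiceType.

(* The letter (x, false) stands for x and (x, true) for its inverse. *)
Definition gword := seq (X * bool).

Definition winv (w : gword) : gword := rev [seq (l.1, ~~ l.2) | l <- w].

(* The smallest congruence on words that contains the relations R and the free
   cancellations x x^-1 = x^-1 x = 1. *)
Inductive pcong (R : gword -> gword -> Prop) : gword -> gword -> Prop :=
| pcong_rel u v of R u v : pcong R u v
| pcong_cancel x b : pcong R [:: (x, b); (x, ~~ b)] [::]
| pcong_refl u : pcong R u u
| pcong_sym u v of pcong R u v : pcong R v u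
| pcong_trans u v w of pcong R u v & pcong R v w : pcong R u w
| pcong_cat u u' v v' of pcong R u u' & pcong R v v' :
    pcong R (u ++ v) (u' ++ v').

Variable R : gword -> gword -> Prop.

Definition pcongb : rel gword := fun u v => `[< pcong R u v >].

Fact pcongb_equiv : equiv_class_of pcongb.
Proof.
split.
- by move=> u; apply/asboolP; apply: pcong_refl.
- by move=> u v; apply/asboolP/asboolP; apply: pcong_sym.
- by move=> v u w /asboolP uv /asboolP vw; apply/asboolP; apply: pcong_trans vw.
Qed.

Canonical pcongb_equiv_rel := EquivRelPack pcongb_equiv.

(* The group < X | R >. *)
Definition presented := {eq_quot pcongb_equiv_rel}.
HB.instance Definition _ := Choice.on presented.

Definition pres_word (u : gword) : presented := \pi_presented u.

Lemma pres_eqP (u v : gword) : pres_word u = pres_word v <-> pcong R u v.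
Proof.
split=> [/eqquotP/asboolP //|uv].
by apply/eqquotP/asboolP.
Qed.

Definition pres_one : presented := pres_word [::].
Definition pres_mul (a b : presented) : presented :=
  pres_word (repr a ++ repr b).
Definition pres_inv (a : presented) : presented := pres_word (winv (repr a)).

Lemma pres_reprK (a : presented) : pres_word (repr a) = a.
Proof. exact: reprK. Qed.

Lemma repr_word (u : gword) : pcong R (repr (pres_word u)) u.
Proof. apply/pres_eqP; exact: pres_reprK. Qed.

Lemma pres_mul_word (u v : gword) :
  pres_mul (pres_word u) (pres_word v) = pres_word (u ++ v).
Proof. by apply/pres_eqP; apply: pcong_cat; apply: repr_word. Qed.

Lemma winv_cons l (u : gword) : winv (l :: u) = winv u ++ [:: (l.1, ~~ l.2)].
Proof. by rewrite /winv /= rev_cons cats1. Qed.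

Lemma winvK : involutive winv.
Proof.
move=> u; rewrite /winv map_rev revK -map_comp -[RHS]map_id.
by apply: eq_map => -[x b] /=; rewrite negbK.
Qed.

Lemma winvl (u : gword) : pcong R (winv u ++ u) [::].
Proof.
elim: u => [|[x b] u IH]; first exact: pcong_refl.
rewrite winv_cons -catA /= -[_ :: _ :: u]/([:: (x, ~~ b); (x, b)] ++ u).
apply: pcong_trans IH; apply: pcong_cat; first exact: pcong_refl.
rewrite -[in X in pcong R _ X](cat0s u); apply: pcong_cat (pcong_refl _ _).
by rewrite -[in X in [:: _; X]](negbK b); apply: pcong_cancel.
Qed.

Lemma winvr (u : gword) : pcong R (u ++ winv u) [::].
Proof. by rewrite -{1}(winvK u); apply: winvl. Qed.

Fact pres_mulA : associative pres_mul.
Proof.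
move=> a b d; rewrite -(pres_reprK a) -(pres_reprK b) -(pres_reprK d).
rewrite (pres_mul_word (repr b) (repr d)) (pres_mul_word (repr a) (repr b)).
by rewrite (pres_mul_word (repr a) (_ ++ _)) (pres_mul_word (_ ++ _)) catA.
Qed.

Fact pres_mul1l : left_id pres_one pres_mul.
Proof. by move=> a; rewrite -(pres_reprK a) pres_mul_word. Qed.

Fact pres_mul1r : right_id pres_one pres_mul.
Proof. by move=> a; rewrite -(pres_reprK a) pres_mul_word cats0. Qed.

Fact pres_mulVl : left_inverse pres_one pres_inv pres_mul.
Proof.
move=> a; rewrite -{2}(pres_reprK a) pres_mul_word; apply/pres_eqP; exact: winvl.
Qed.

Fact pres_mulVr : right_inverse pres_one pres_inv pres_mul.
Proof.
move=> a; rewrite -{1}(pres_reprK a) pres_mul_word; apply/pres_eqP; exact: winvr.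
Qed.

HB.instance Definition _ := isGroup.Build presented
  pres_mulA pres_mul1l pres_mul1r pres_mulVl pres_mulVr.

Lemma pres_wordM (u v : gword) :
  pres_word u * pres_word v = pres_word (u ++ v).
Proof. exact: pres_mul_word. Qed.

Definition pres_gen (x : X) : presented := pres_word [:: (x, false)].

End Presentation.

(* Some i is the generator s_i, with the indices 1 <= i < n of the usual
   presentation; None is the generator c. *)
Definition spin_gen (n : nat) : choiceType := option {i : nat | 0 < i < n}%N.

Section Spin.
Variable n : nat.

Local Notation S i := (Some i : spin_gen n, false).
Local Notation C := (None : spin_gen n, false).

Inductive spin_rel : gword (spin_gen n) -> gword (spin_gen n) -> Prop :=
| spin_rel_cc : spin_rel [:: C; C] [::]
| spin_rel_cs (i : {i : nat | 0 < i < n}%N) : spin_rel [:: C; S i] [:: S i; C]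
| spin_rel_ss (i : {i : nat | 0 < i < n}%N) : spin_rel [:: S i; S i] [::]
| spin_rel_braid (i j : {i : nat | 0 < i < n}%N) of
    val j = (val i).+1 :
    spin_rel [:: S i; S j; S i] [:: S j; S i; S j]
| spin_rel_far (i j : {i : nat | 0 < i < n}%N) of
    ((val i).+2 <= val j)%N || ((val j).+2 <= val i)%N :
    spin_rel [:: S i; S j] [:: C; S j; S i].

Definition spin : groupType := presented spin_rel.

Definition spin_c : spin := pres_gen spin_rel None.

(* Only the indices 0 < i < n are meaningful; the others are sent to 1. *)
Definition spin_s (i : nat) : spin :=
  if insub i is Some j then pres_gen spin_rel (Some j) else 1.

(* sigma_{k,i} and tau_{k,l} inside the spin-symmetric group on n letters. *)
Definition spin_sigma (k i : nat) : spin :=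
  \prod_(i <= j < i + k) spin_s j.

(* The index i' = l - i runs down from l to 1. *)
Definition spin_tau (k l : nat) : spin :=
  \prod_(0 <= i < l) spin_sigma k (l - i).

End Spin.

(* Main.v *)
(** Inverting [tau_{n,m}] reverses its factors, so the inverse is the product of
    the [s_(i + j)] over the cells [(i, j)] of an [m x n] grid, read by
    increasing [i] and then decreasing [j].  The element [tau_{m,n}] is the
    product over the same cells, read by decreasing [j] and then increasing [i].
    The two orders differ exactly on the pairs of cells with [i < i'] and
    [j < j'].  Then [i + j] and [i' + j'] differ by at least 2, so each of these
    ['C(n, 2) * 'C(m, 2)] pairs contributes one factor [c]. *)

Require Import Defs.
From mathcomp Require Import all_boot.
From mathcomp Require Import zify.

Set Implicit Arguments.
Unset Strict Implicit.
Unset Printing Implicit Defensive.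

Local Open Scope group_scope.

Section TwistedProducts.
Variables (G : groupType) (c : G).

(** The factors cancel from the middle outwards, starting with [x 0 * y 0]. *)
Lemma prodg_rev_mul1 (x y : nat -> G) k :
    (forall i, (i < k)%N -> x i * y i = 1) ->
  \prod_(0 <= i < k) x (k - i.+1)%N * \prod_(0 <= i < k) y i = 1.
Proof.
elim: k => [|k IH] xy; first by rewrite !big_nil mulg1.
rewrite big_nat_recl // big_nat_recr //= subSS subn0 mulgA -(mulgA (x k)).
under eq_bigr => i _ do rewrite subSS.
rewrite IH ?mulg1 => [|i ik]; first exact: xy.
by apply: xy; apply: ltnW.
Qed.

Hypothesis c_central : forall x : G, commute x c.

Lemma mulgCX (x : G) a : x * c ^+ a = c ^+ a * x.
Proof. exact/commuteX/c_central. Qed.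

Lemma twist_prodr (x : G) (y : nat -> G) a k :
    (forall j, (j < k)%N -> x * y j = c ^+ a * y j * x) ->
  x * \prod_(0 <= j < k) y j = c ^+ (a * k) * \prod_(0 <= j < k) y j * x.
Proof.
elim: k => [|k IH] xy; first by rewrite muln0 expg0 !big_nil !mulg1 mul1g.
rewrite big_nat_recr //= mulgA IH => [|j jk]; last exact/xy/ltnW.
rewrite -mulgA xy // mulnS addnC expgnDr !mulgA.
by congr (_ * _ * _); rewrite -!mulgA mulgCX.
Qed.

Hypothesis cc : c * c = 1.

(** As [c * c = 1], the central element [c ^+ a] is its own inverse. *)
Lemma twistC (x y : G) a :
  x * y = c ^+ a * y * x -> y * x = c ^+ a * x * y.
Proof.
move=> xy; rewrite -(mulgA _ x) xy !mulgA -expgMn; last exact: c_central.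
by rewrite cc expg1n mul1g.
Qed.

(** Moving every [x j] in front of the [y j'] with [j' < j] costs [c ^+ a] for each of the
    ['C(k, 2)] pairs. *)
Lemma prodg_twist_split (x y : nat -> G) a k :
    (forall j' j, (j' < j < k)%N -> y j' * x j = c ^+ a * x j * y j') ->
  \prod_(0 <= j < k) (x j * y j) =
    c ^+ (a * 'C(k, 2)) * (\prod_(0 <= j < k) x j * \prod_(0 <= j < k) y j).
Proof.
elim: k => [|k IH] yx; first by rewrite muln0 expg0 !big_nil !mulg1.
rewrite !big_nat_recr //= IH => [|j' j /andP[j'j jk]]; last first.
  by apply: yx; rewrite j'j ltnW.
have /twistC yxk : x k * \prod_(0 <= j < k) y j =
    c ^+ (a * k) * \prod_(0 <= j < k) y j * x k.
  by apply: twist_prodr => j jk; apply/twistC/yx; rewrite jk /=.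
rewrite binS bin1 mulnDr expgnDr -!mulgA; congr (_ * _).
rewrite (mulgA (\prod_(0 <= j < k) y j)) yxk !mulgA.
by rewrite mulgCX.
Qed.

Lemma exchange_prodg_twist (b : nat -> nat -> G) m n :
    (forall i i' j' j, (i < i' < m)%N -> (j' < j < n)%N ->
       b i j * b i' j' = c * b i' j' * b i j) ->
  \prod_(0 <= j < n) \prod_(0 <= i < m) b i j =
    c ^+ ('C(n, 2) * 'C(m, 2)) *
      \prod_(0 <= i < m) \prod_(0 <= j < n) b i j.
Proof.
elim: m => [|m IH] bb.
  rewrite muln0 expg0 mul1g big_nil.
  by under eq_bigr => j _ do rewrite big_nil; rewrite big1.
under eq_bigr => j _ do rewrite big_nat_recr //=.
(* The last row [b m] is pulled out of the columns. Each crossing passes [m] factors, so the cost is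
   [m * 'C(n, 2)], the increment in Pascal's rule for ['C(m.+1, 2)]. *)
rewrite (@prodg_twist_split _ _ m) => [|j' j jj]; last first.
  rewrite -[m in c ^+ m]mul1n.
  by apply: twist_prodr => i im; apply: twistC; apply: bb => //; lia.
rewrite IH => [|i i' j' j /andP[ii im] jj]; last by apply: bb => //; lia.
by rewrite big_nat_recr //= binS bin1 mulnDr addnC expgnDr (mulnC m) !mulgA.
Qed.

End TwistedProducts.

Section SpinRelations.
Variable n : nat.

Lemma spin_cc : spin_c n * spin_c n = 1.
Proof. by rewrite pres_wordM; apply/pres_eqP/pcong_rel/spin_rel_cc. Qed.

Lemma spin_c_central (x : spin n) : commute x (spin_c n).
Proof.
rewrite -(pres_reprK x).
elim: (repr x) => [|[y b] w IH]; first by rewrite /commute mulg1 mul1g.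
have gen_c (z : spin_gen n) : commute (pres_gen (@spin_rel n) z) (spin_c n).
  case: z => [i|] //; rewrite /commute !pres_wordM; apply/esym.
  exact/pres_eqP/pcong_rel/spin_rel_cs.
rewrite -cat1s -pres_wordM; apply/commute_sym/commuteM/commute_sym/IH.
case: b; last exact/commute_sym/gen_c.
(* The relations only mention positive letters; an inverse letter commutes with [c] because its
   generator does. *)
have -> : pres_word (@spin_rel n) [:: (y, true)] = (pres_gen (@spin_rel n) y)^-1.
  apply/esym/mulg1_eq; rewrite pres_wordM; exact/pres_eqP/pcong_cancel.
exact/commuteV/commute_sym/gen_c.
Qed.

Lemma spin_ss i : spin_s n i * spin_s n i = 1.
Proof.
rewrite /spin_s; case: insubP => [j _ _|_]; last exact: mulg1.
by rewrite pres_wordM; apply/pres_eqP/pcong_rel/spin_rel_ss.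
Qed.

Lemma spin_far i j : (0 < i)%N -> (i.+2 <= j)%N -> (j < n)%N ->
  spin_s n i * spin_s n j = spin_c n * spin_s n j * spin_s n i.
Proof.
move=> i0 ij jn; rewrite /spin_s.
case: insubP => [u _ ui|]; last by lia.
case: insubP => [v _ vj|]; last by lia.
rewrite (pres_wordM _ [:: (None, false)] [:: (Some v, false)]) !pres_wordM; apply/pres_eqP/pcong_rel.
by apply: spin_rel_far; rewrite ui vj ij.
Qed.

Lemma spin_sigmaE k i :
  spin_sigma n k i = \prod_(0 <= j < k) spin_s n (j + i).
Proof. by rewrite /spin_sigma -{1}[i]add0n big_addn addKn. Qed.

Lemma spin_tau_mul1 k l :
  spin_tau n k l *
    \prod_(0 <= i < l) \prod_(0 <= j < k) spin_s n (i + (k - j)) = 1.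
Proof.
(* The cancellation is used twice: first between whole rows, then between the generators inside row
   [i]. *)
rewrite -[RHS](@prodg_rev_mul1 _ (fun i => spin_sigma n k i.+1)
  (fun i => \prod_(0 <= j < k) spin_s n (i + (k - j))) l) => [|i _].
  congr (_ * _); rewrite /spin_tau; apply: eq_big_nat => i il.
  by congr spin_sigma; lia.
rewrite -[RHS](@prodg_rev_mul1 _ (fun j => spin_s n (i + (k - j)))
  (fun j => spin_s n (i + (k - j))) k) => [|j _]; last exact: spin_ss.
congr (_ * _); rewrite spin_sigmaE; apply: eq_big_nat => j jk.
by congr spin_s; lia.
Qed.

End SpinRelations.

Theorem proposition5p3 (n m : nat) :
  (spin_tau (n + m) n m * spin_tau (n + m) m n
   = spin_c (n + m) ^+ ('C(n, 2) * 'C(m, 2)))%g.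
Proof.
(* Columns are numbered backwards, cell [(i, j)] holding the generator of index [i + (n - j)], so
   that both readings of the grid increase in [i] and in [j]. *)
have -> : spin_tau (n + m) m n =
    \prod_(0 <= j < n) \prod_(0 <= i < m) spin_s (n + m) (i + (n - j)).
  by apply: eq_bigr => j _; apply: spin_sigmaE.
rewrite (exchange_prodg_twist (@spin_c_central _) (spin_cc _)); last first.
  (* From [i < i'] and [j' < j], both summands of the index grow by at least 1, and all indices lie
     between 1 and [n + m - 1]. *)
  by move=> i i' j' j ii jj; apply: spin_far; lia.
rewrite mulgA mulgCX; last exact: spin_c_central.
by rewrite -mulgA spin_tau_mul1 mulg1.
Qed.
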